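(* Let $X,Y$ be Banach spaces, $F:X\rightrightarrows Y$ a closed multifunction, $A\subset X$ a closed set, $b\in Y$, and $S:=\{x\in A:\ b\in F(x)\}$. Let $z\in S$ and $\tau\in(0,+\infty)$. (i) Suppose that $$\overline{D_cF^{-1}(b,z)(\tfrac1\tau B_Y)}\cap\overline{T_c(A,z)+\tfrac1\tau B_X}\subset\overline{T_c(S,z)+B_X}.$$ Then $$N_c(S,z)\cap B_{X^*}\subset\tau\big(D_c^*F(z,b)(B_{Y^*})+N_c(A,z)\cap B_{X^*}\big).\qquad(\mathrm{C})$$ (ii) Suppose that $$\overline{D_cF^{-1}(b,z)(\tfrac1\tau B_Y)}\cap\overline{T_c(A,z)+\tfrac1\tau B_X}\subset\overline{T(S,z)+B_X}.$$ Then $$\hat N(S,z)\cap B_{X^*}\subset\tau\big(D_c^*F(z,b)(B_{Y^*})+N_c(A,z)\cap B_{X^*}\big).\qquad(\mathrm{Fr})$$ (iii) Suppose that (C) holds. Then $$\overline{D_cF^{-1}(b,z)(\eta_1B_Y)}\cap\overline{T_c(A,z)+\eta_2B_X}\subset\overline{T_c(S,z)+B_X}$$ for all $\eta_1,\eta_2\in[0,+\infty)$ with $\eta_1+\eta_2\le\frac1\tau$. (iv) Suppose that $X$ is finite-dimensional and (Fr) holds. Then $$\overline{D_cF^{-1}(b,z)(\eta_1B_Y)}\cap\overline{T_c(A,z)+\eta_2B_X}\subset\overline{\mathrm{co}(T(S,z))+B_X}$$ for all $\eta_1,\eta_2\in[0,+\infty)$ with $\eta_1+\eta_2\le\frac1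\tau$.
   Context: $B_X,B_Y,B_{X^*},B_{Y^*}$ are the closed unit balls of $X,Y$ and the dual spaces $X^*,Y^*$; bars denote norm closure, $\mathrm{co}$ the convex hull, and sums of sets are Minkowski sums. A multifunction $F$ is closed if its graph $\mathrm{gph}(F)=\{(x,y)\in X\times Y: y\in F(x)\}$ is closed; $F^{-1}:Y\rightrightarrows X$ is defined by $x\in F^{-1}(y)\iff y\in F(x)$. For a closed set $C$ in a Banach space and $a\in C$: the Clarke tangent cone $T_c(C,a)$ is the set of $v$ such that for all sequences $a_n\to a$ with $a_n\in C$ and $t_n\to0^+$ there exist $v_n\to v$ with $a_n+t_nv_n\in C$ for all $n$; the contingent (Bouligand) cone $T(C,a)$ is the set of $v$ for which there exist $v_n\to v$ and $t_n\to0^+$ with $a+t_nv_n\in C$ for all $n$; the Clarke normal cone $N_c(C,a)$ is the set of continuous linear functionals $x^*$ with $\langle x^*,h\rangle\le0$ for all $h\in T_c(C,a)$; the Fréchet normal cone $\hat N(C,a)$ is the set of continuous linear functionals $x^*$ with $\limsup_{y\to a,\,y\in C}\frac{\langle x^*,y-a\rangle}{\|y-a\|}\le0$. For $(x,y)\in\mathrm{gph}(F)$ and $y^*\in Y^*$, the Clarke coderivative is $D_c^*F(x,y)(y^* )=\{x^*\in X^*:(x^*,-y^* )\in N_c(\mathrm{gph}(F),(x,y))\}$. The Clarke tangent derivative $D_cF^{-1}(b,z):Y\rightrightarrows X$ of $F^{-1}$ at $(b,z)$ is the multifunction with graph $T_c(\mathrm{gph}(F^{-1}),(b,z))$. The image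 of a set $V$ under a multifunction $\Phi$ is $\Phi(V)=\bigcup_{v\in V}\Phi(v)$. Condition (C) is called the strong BCQ in the sense of Clarke at $z$ with constant $\tau$, and (Fr) the strong BCQ in the sense of Fréchet at $z$ with constant $\tau$. *)

(* Defs.v *)
From HB Require Import structures.
From mathcomp Require Import all_boot all_order all_algebra.
From mathcomp Require Import all_classical all_reals all_analysis.
Set Implicit Arguments.
Unset Strict Implicit.
Unset Printing Implicit Defensive.
Import Order.TTheory GRing.Theory Num.Theory.
Import numFieldNormedType.Exports.
Local Open Scope classical_set_scope.
Local Open Scope ring_scope.

Definition set_add (V : zmodType) (A B : set V) : set V :=
  [set x + y | x in A & y in B].

Definition set_scale (R : pzRingType) (V : lmodType R) (c : R) (A : set V)
  : set V := [set c *: x | x in A].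

(* `closed_ball` is the closure of the open ball; in a normed space it is
   the set of x with `|x| <= 1 (closed_ballE). *)
Definition unit_ball (R : realType) (V : normedModType R) : set V :=
  closed_ball (0 : V) 1.
Arguments unit_ball {R} V.

Definition convex_hull (R : realType) (V : lmodType R) (A : set V) : set V :=
  smallest (@convex_set R V) A.

Definition finite_dimensional (R : realType) (V : lmodType R) : Prop :=
  exists (n : nat) (e : 'I_n -> V),
    forall x : V, exists c : 'I_n -> R, x = \sum_(i < n) c i *: e i.
Arguments finite_dimensional {R} V.

(* The dual space, as a set of functions; sums and multiples of functionals
   are those of the lmodType V -> R^o. *)
Definition dual (R : realType) (V : normedModType R) : set (V -> R^o) :=
  [set f : V -> R^o | linear f /\ continuous f].
Arguments dual {R} V.

Definition dual_norm (R : realType) (V : normedModType R) (f : V -> R^o) : R :=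
  sup [set `|f x| | x in unit_ball V].

Definition dual_unit_ball (R : realType) (V : normedModType R)
  : set (V -> R^o) :=
  [set f | dual V f /\ dual_norm f <= 1].
Arguments dual_unit_ball {R} V.

Definition dual_pair (R : realType) (X Y : normedModType R)
  (f : X -> R^o) (g : Y -> R^o) : (X * Y)%type -> R^o :=
  fun p => f p.1 + g p.2.

Definition clarke_tangent (R : realType) (V : normedModType R) (C : set V)
  (a : V) : set V :=
  [set v | forall (a_ : nat -> V) (t_ : nat -> R),
    (forall n, C (a_ n)) -> a_ @ \oo --> a ->
    (forall n, 0 < t_ n) -> t_ @ \oo --> (0 : R) ->
    exists2 v_ : nat -> V, v_ @ \oo --> v &
      forall n, C (a_ n + t_ n *: v_ n)].

Definition contingent_cone (R : realType) (V : normedModType R) (C : set V)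
  (a : V) : set V :=
  [set v | exists (v_ : nat -> V) (t_ : nat -> R),
    [/\ v_ @ \oo --> v, forall n, 0 < t_ n, t_ @ \oo --> (0 : R) &
      forall n, C (a + t_ n *: v_ n)]].

Definition clarke_normal (R : realType) (V : normedModType R) (C : set V)
  (a : V) : set (V -> R^o) :=
  [set f | dual V f /\ forall h, clarke_tangent C a h -> f h <= 0].

(* The quotient only makes sense for y <> a, whence the punctured
   neighbourhoods a^'. If a is isolated in C the limsup is -oo. *)
Definition frechet_normal (R : realType) (V : normedModType R) (C : set V)
  (a : V) : set (V -> R^o) :=
  [set f | dual V f /\
    (limf_esup (fun y : V => (f (y - a) / `|y - a|)%:E) (within C a^')
       <= 0)%E].

Definition multifunction (U V : Type) := U -> set V.

Definition graph (U V : Type) (F : multifunction U V) : set (U * V) :=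
  [set p | F p.1 p.2].

Definition multi_inv (U V : Type) (F : multifunction U V)
  : multifunction V U := fun y => [set x | F x y].

Definition multi_image (U V : Type) (F : multifunction U V) (A : set U)
  : set V := \bigcup_(u in A) F u.

Definition clarke_derivative (R : realType) (X Y : normedModType R)
  (F : multifunction X Y) (x : X) (y : Y) : multifunction X Y :=
  fun u => [set v | clarke_tangent (graph F : set (X * Y)%type) (x, y) (u, v)].

Definition clarke_coderivative (R : realType) (X Y : normedModType R)
  (F : multifunction X Y) (x : X) (y : Y)
  : multifunction (Y -> R^o) (X -> R^o) :=
  fun ys => [set xs | dual X xs /\
    clarke_normal (graph F : set (X * Y)%type) (x, y) (dual_pair xs (- ys))].

Definition solution_set (U V : Type) (F : multifunction U V) (A : set U)
  (b : V) : set U := [set x | A x /\ F x b].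

Section strong_BCQ.
Variables (R : realType) (X Y : normedModType R).
Variables (F : multifunction X Y) (A : set X) (b : Y) (z : X) (tau : R).

Definition BCQ_bound : set (X -> R^o) :=
  set_scale tau
    (set_add (multi_image (clarke_coderivative F z b) (dual_unit_ball Y))
             (clarke_normal A z `&` dual_unit_ball X)).

Definition strong_BCQ_clarke : Prop :=
  clarke_normal (solution_set F A b) z `&` dual_unit_ball X `<=` BCQ_bound.

Definition strong_BCQ_frechet : Prop :=
  frechet_normal (solution_set F A b) z `&` dual_unit_ball X `<=` BCQ_bound.

End strong_BCQ.

(* Main.v *)
Require Import Defs.
From HB Require Import structures.
From mathcomp Require Import all_boot all_order all_algebra.
From mathcomp Require Import all_classical all_reals all_analysis.
From mathcomp Require Import ring lra.
Set Implicit Arguments.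
Unset Strict Implicit.
Unset Printing Implicit Defensive.
Import Order.TTheory GRing.Theory Num.Theory.
Import numFieldNormedType.Exports.
Local Open Scope classical_set_scope.
Local Open Scope ring_scope.

(** Write [K] for the Clarke tangent cone of the graph of [F^-1] at [(b, z)] and [T] for
    that of [A] at [z]; both are convex cones ([clarke_tangent_cone]), and so are the
    cones [C] used for [S]: its Clarke tangent cone, and the convex hull of its
    contingent cone. All four parts come from a duality between inclusions of sets of
    the form cone plus ball and decompositions of functionals.

    For (i) and (ii), let [f] be of norm at most 1 and nonpositive on the tangent cone of
    [S] in question; Frechet normals are nonpositive on the contingent cone
    ([frechet_normal_contingent]). Then [f <= 1] on the right-hand side of the inclusion,
    hence on its left-hand side. By homogeneity this means [f x / tau <= |y| + |x - t|]
    for [(y, x)] in [K] and [t] in [T], and the Hahn-Banach theorem, in the form of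
    [sandwich], splits [f / tau] into an element of the coderivative and a normal to [A]
    ([BCQ_bound_of_le1]).

    For (iii) and (iv), a point outside the closure of [C + B] is separated from it by some
    [f] of norm at most 1, nonpositive on [C], with [f x > 1] ([separate_cone_ball]). This
    [f] is normal to [S], so the strong BCQ decomposes it, and the decomposition forces
    [f x <= 1] on the left-hand side ([BCQ_bound_le1]). In (iv) one also has to know that a functional
    nonpositive on the contingent cone is a Frechet normal; this is where finite dimension
    enters, through the compactness of the unit ball ([contingent_frechet_normal],
    [finite_dimensional_compact_ball]).

    Hahn-Banach itself is obtained without extending functionals step by step: Zorn's lemma
    yields a minimal sublinear functional below a given one, and minimal sublinear
    functionals are linear. *)

(** * Sublinear functionals and the sandwich theorem *)

(** The homogeneity axiom is an inequality, which is what infimum constructions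
    deliver directly; equality for positive scalars follows by applying it to the
    inverse scalar, and the value at 0 by [sublinear0]. *)
Definition sublinear (R : realType) (V : lmodType R) (p : V -> R) : Prop :=
  (forall u v, p (u + v) <= p u + p v) /\
  (forall a v, 0 <= a -> p (a *: v) <= a * p v).

Definition convex_cone (R : realType) (V : lmodType R) (C : set V) : Prop :=
  [/\ C 0, forall u v, C u -> C v -> C (u + v) &
      forall a v, 0 < a -> C v -> C (a *: v)].

Lemma sublinear0 (R : realType) (V : lmodType R) (p : V -> R) :
  sublinear p -> p 0 = 0.
Proof.
move=> [pD pZ].
have := pD 0 0; have := pZ 0 0 (lexx 0); rewrite addr0 scale0r mul0r.
lra.
Qed.

(** The largest candidate [q v = inf over (w, r) in H of p (v + w) - r] works: the
    infimum is bounded below by [- p (- v)] because [r <= p w <= p (v + w) + p (- v)],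
    and it is sublinear because [H] is a convex cone. Taking [v = - w], any linear
    functional below [q] takes a value at least [r] at [w]: this converts lower
    bounds on [H] into one upper bound. *)
Lemma sublinear_tilt (R : realType) (V : lmodType R) (p : V -> R)
  (H : set (V * R^o)%type) :
  sublinear p -> convex_cone H -> (forall w, H w -> w.2 <= p w.1) ->
  exists2 q : V -> R, sublinear q &
    (forall v, q v <= p v) /\ (forall v w, H w -> q v <= p (v + w.1) - w.2).
Proof.
move=> psub [H0 HD HZ] Hp; have [pD pZ] := psub.
pose E v := [set p (v + w.1) - w.2 | w in H].
have En v : E v !=set0 by exists (p (v + 0) - 0), 0.
have Elb v : lbound (E v) (- p (- v)).
  move=> _ [w Hw <-]; have := Hp _ Hw.
  have := pD (v + w.1) (- v); rewrite addrAC subrr add0r; lra.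
have qle v w : H w -> inf (E v) <= p (v + w.1) - w.2.
  by move=> Hw; apply: ge_inf; [exists (- p (- v)); exact: Elb | exists w].
have qge v r : (forall w, H w -> r <= p (v + w.1) - w.2) -> r <= inf (E v).
  by move=> h; apply: lb_le_inf => // _ [w Hw <-]; exact: h.
have qp v : inf (E v) <= p v by have := qle v 0 H0; rewrite addr0 subr0.
exists (fun v => inf (E v)); last by [].
split=> [u v|a v].
- rewrite -lerBlDr; apply: (qge) => w Hw; rewrite lerBlDl -lerBlDr.
  apply: qge => w' Hw'.
  have := qle (u + v) _ (HD _ _ Hw Hw') => /=.
  have := pD (u + w.1) (v + w'.1); rewrite addrACA.
  by move: (p _) (p _) (p _) => x y t; lra.
- rewrite le_eqVlt => /predU1P[<-|a0].
    by rewrite scale0r mul0r -(sublinear0 psub); exact: qp.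
  rewrite mulrC -ler_pdivrMr//; apply: qge => w Hw; rewrite ler_pdivrMr//.
  have := qle (a *: v) _ (HZ _ _ a0 Hw) => /=; rewrite -scalerDr.
  have := pZ a (v + w.1) (ltW a0).
  have -> : a *: w.2 = a * w.2 by [].
  by move: (p _) (p _) => x y; nra.
Qed.

(** Zorn's lemma for the reverse pointwise order: a chain of sublinear functionals
    below [p] has its pointwise infimum as a bound, finite because every sublinear
    [q <= p] satisfies [- p (- v) <= q v]. *)
Lemma minimal_sublinear (R : realType) (V : lmodType R) (p : V -> R) :
  sublinear p ->
  exists2 m : V -> R, sublinear m /\ (forall v, m v <= p v) &
    forall q, sublinear q -> (forall v, q v <= m v) -> q = m.
Proof.
move=> psub.
pose T := {q : V -> R | sublinear q /\ forall v, q v <= p v}.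
pose below (s t : T) := `[< forall v, sval t v <= sval s v >].
have lb (s : T) v : - p (- v) <= sval s v.
  case: s => q [qs qp] /=; have := qp (- v).
  have := qs.1 v (- v); rewrite subrr (sublinear0 qs); lra.
have [//|s t u /asboolP st /asboolP tu|s t /asboolP st /asboolP ts|A Atot|t tmin]
  := Zorn (R := below).
- by move=> t; apply/asboolP => v.
- by apply/asboolP => v; exact: le_trans (tu v) (st v).
- case: s t st ts => [s ps] [t pt] /= st ts; apply: eq_exist => //.
  by apply/funext => v; apply/eqP; rewrite eq_le st ts.
- have [[s0 As0]|A0] := pselect (exists s, A s); last first.
    (* The empty chain is bounded by [p] itself. *)
    exists (exist _ p (conj psub (fun v => lexx (p v)))) => s As.
    by exfalso; apply: A0; exists s.
  pose E v := [set sval s v | s in A].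
  have En v : E v !=set0 by exists (sval s0 v), s0.
  have mle v s : A s -> inf (E v) <= sval s v.
    move=> As; apply: ge_inf; last by exists s.
    by exists (- p (- v)) => _ [t _ <-].
  have mge v r : (forall s, A s -> r <= sval s v) -> r <= inf (E v).
    by move=> h; apply: lb_le_inf => // _ [t At <-]; exact: h.
  have msub : sublinear (fun v => inf (E v)).
    split=> [u v|a v a0].
      rewrite -lerBlDr; apply: (mge) => s As; rewrite lerBlDl -lerBlDr.
      apply: mge => t At; rewrite lerBlDr.
      have [/asboolP st|/asboolP ts] := Atot _ _ As At.
        have := mle (u + v) _ At; have := (svalP t).1.1 u v.
        by have := st u; lra.
      have := mle (u + v) _ As; have := (svalP s).1.1 u v.
      by have := ts v; lra.
    move: a0; rewrite le_eqVlt => /predU1P[<-|a0].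
      rewrite scale0r mul0r.
      by have := mle 0 _ As0; rewrite (sublinear0 (svalP s0).1).
    rewrite mulrC -ler_pdivrMr//; apply: mge => s As; rewrite ler_pdivrMr//.
    have := mle (a *: v) _ As; have := (svalP s).1.2 a v (ltW a0).
    by rewrite mulrC; lra.
  have mp v : inf (E v) <= p v.
    exact: le_trans (mle v _ As0) ((svalP s0).2 v).
  exists (exist _ (fun v => inf (E v)) (conj msub mp)) => s As.
  by apply/asboolP => v /=; exact: mle.
exists (sval t); first exact: (svalP t).
move=> q qs qt.
have qp v : q v <= p v by exact: le_trans (qt v) ((svalP t).2 v).
by rewrite -(tmin (exist _ q (conj qs qp)))//; apply/asboolP => v /=.
Qed.

(** Tilting [m] along the ray through a vector [v] produces a sublinear
    functional below [m], hence [m] itself by minimality; this gives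
    [m u <= m (u + v) - m v], the inequality missing for additivity. *)
Lemma minimal_sublinear_linear (R : realType) (V : lmodType R) (m : V -> R^o) :
  sublinear m -> (forall q, sublinear q -> (forall v, q v <= m v) -> q = m) ->
  linear m.
Proof.
move=> ms mmin; have [mD mZ] := ms.
have mDE u v : m (u + v) = m u + m v.
  pose H : set (V * R^o)%type := [set (s *: v, s * m v) | s in [set s : R | 0 <= s]].
  have [|w [s /= s0 <-]|q qs [qm qle]] := @sublinear_tilt R V m H ms.
  - split.
    + by exists 0 => //=; rewrite scale0r mul0r.
    + move=> _ _ [s /= s0 <-] [t /= t0 <-]; exists (s + t); first exact: addr_ge0.
      by rewrite scalerDl mulrDl.
    + move=> a _ a0 [s /= s0 <-]; exists (a * s); first exact: (mulr_ge0 (ltW a0) s0).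
      by rewrite -scalerA -mulrA.
  - move: s0; rewrite le_eqVlt => /predU1P[<-|s0] /=.
      by rewrite scale0r mul0r (sublinear0 ms).
    have := mZ s^-1 (s *: v); rewrite scalerA mulVf ?gt_eqF// scale1r.
    by rewrite invr_ge0 (ltW s0) => /(_ isT); rewrite ler_pdivlMl.
  - have := qle u (v, m v); rewrite (mmin _ qs qm) /=.
    have Hv : H (v, m v) by exists 1; rewrite /= ?scale1r ?mul1r.
    move=> /(_ Hv); rewrite lerBrDr => h; apply/eqP; rewrite eq_le h andbT.
    exact: mD.
have mN v : m (- v) = - m v.
  by apply/eqP; rewrite -addr_eq0 addrC -mDE subrr (sublinear0 ms).
have mZE a v : 0 <= a -> m (a *: v) = a * m v.
  move=> a0; apply/eqP; rewrite eq_le mZ//=.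
  by have := mZ a (- v) a0; rewrite scalerN !mN mulrN lerN2.
move=> a u v; rewrite mDE; congr (_ + _).
have [a0|a0] := leP 0 a; first exact: (mZE _ _ a0).
have -> : a *: u = - (- a *: u) by rewrite scaleNr opprK.
rewrite mN mZE ?oppr_ge0 ?ltW//.
by rewrite mulNr opprK.
Qed.

(** Hahn-Banach theorem in Mazur-Orlicz form. The lower bound is prescribed on a
    convex cone [H] of pairs (vector, value), so extension of functionals,
    separation and the splitting of a functional between two cones all become
    choices of [H]. *)
Lemma sandwich (R : realType) (V : lmodType R) (p : V -> R)
  (H : set (V * R^o)%type) :
  sublinear p -> convex_cone H -> (forall w, H w -> w.2 <= p w.1) ->
  exists2 f : V -> R^o, linear f &
    (forall v, f v <= p v) /\ (forall w, H w -> w.2 <= f w.1).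
Proof.
move=> ps Hc Hp; have [q qs [qp qle]] := sublinear_tilt ps Hc Hp.
have [m [ms mq] mmin] := minimal_sublinear qs.
have ml := minimal_sublinear_linear ms mmin.
exists m => //; split=> [v|w Hw]; first exact: le_trans (mq v) (qp v).
have := qle (- w.1) w Hw; rewrite addNr (sublinear0 ps) sub0r.
have := mq (- w.1).
have -> : m (- w.1) = - m w.1.
  by have := ml (-1) w.1 0; rewrite !addr0 (sublinear0 ms) addr0 !scaleN1r.
by move=> h1 h2; have := le_trans h1 h2; rewrite lerN2.
Qed.

(** * Continuous linear functionals and unit balls *)

Lemma linear_canonical (R : realType) (V : lmodType R) (f : V -> R^o) :
  linear f -> exists g : {linear V -> R^o}, f = g :> (V -> R^o).
Proof.
move=> fl; pose isl := GRing.isLinear.Build R V R^o _ f fl.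
by exists (HB.pack_for {linear V -> R^o} f isl).
Qed.

Lemma linear_real (R : realType) (V : lmodType R) (f : V -> R^o) : linear f ->
  [/\ f 0 = 0 :> R, forall u v, f (u + v) = f u + f v :> R &
      forall a v, f (a *: v) = a * f v :> R].
Proof.
move=> /linear_canonical[g ->]; split=> [|u v|a v]; first exact: linear0.
  exact: linearD.
exact: linearZ.
Qed.

Lemma sublinear_norm (R : realType) (V : normedModType R) :
  sublinear (fun v : V => `|v|).
Proof.
by split=> [u v|a v a0]; [exact: ler_normD | rewrite normrZ ger0_norm].
Qed.

Lemma dual_le_norm (R : realType) (V : normedModType R) (f : V -> R^o) (M : R) :
  linear f -> (forall v, f v <= M * `|v|) ->
  dual V f /\ (forall v, `|f v| <= M * `|v|).
Proof.
move=> fl; have [g ->] := linear_canonical fl => gM.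
have gM' v : `|g v| <= M * `|v|.
  by rewrite ler_norml gM andbT lerNl -linearN -[`|v|]normrN.
split=> //; split; first exact: linearP.
apply/linear_bounded_continuous/linear_boundedP.
exists M; split; first exact: num_real.
by move=> r Mr v; apply: le_trans (gM' v) _; rewrite ler_wpM2r// ltW.
Qed.

Lemma in_unit_ball (R : realType) (V : normedModType R) (v : V) :
  unit_ball V v <-> `|v| <= 1.
Proof. by rewrite /unit_ball closed_ballE//= /closed_ball_ /= sub0r normrN. Qed.

Lemma scale_unit_ball (R : realType) (V : normedModType R) (r : R) (v : V) :
  0 <= r -> set_scale r (unit_ball V) v <-> `|v| <= r.
Proof.
move=> r0; split=> [[u /in_unit_ball u1 <-]|vr].
  by rewrite normrZ ger0_norm// ler_piMr.
move: r0; rewrite le_eqVlt => /predU1P[r0|r0].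
  exists 0; first by apply/in_unit_ball; rewrite normr0 ler01.
  by apply/esym/eqP; rewrite scaler0 -normr_le0 r0.
exists (r^-1 *: v); last by rewrite scalerA divff ?gt_eqF// scale1r.
apply/in_unit_ball; rewrite normrZ gtr0_norm ?invr_gt0//.
by rewrite ler_pdivrMl// mulr1.
Qed.

Lemma dual_unit_ballP (R : realType) (V : normedModType R) (f : V -> R^o) :
  dual_unit_ball V f <-> dual V f /\ (forall v, `|f v| <= `|v|).
Proof.
split=> -[fd fn]; split => //; last first.
  apply: ge_sup; first by exists `|f 0|, 0 => //; apply/in_unit_ball; rewrite normr0.
  by move=> _ [v /in_unit_ball v1 <-]; exact: le_trans (fn v) v1.
have ub : has_ubound [set `|f x| | x in unit_ball V].
  have [fl fc] := fd; have [g fg] := linear_canonical fl.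
  move: fc; rewrite fg => /linear_bounded_continuous/linear_boundedP[M [_ hM]].
  exists (Num.max M 0 + 1) => _ [v /in_unit_ball v1 <-].
  have M1 : M < Num.max M 0 + 1 by rewrite ltr_pwDr ?le_max ?lexx.
  apply: le_trans (hM _ M1 v) _; apply: ler_piMr => //.
  by rewrite addr_ge0// le_max lexx orbT.
move=> v; have [->|v0] := eqVneq v 0.
  by have [g ->] := linear_canonical fd.1; rewrite linear0 !normr0.
have vn : 0 < `|v| by rewrite normr_gt0.
have : `|f (`|v|^-1 *: v)| <= 1.
  apply: le_trans fn; apply: ub_le_sup => //; exists (`|v|^-1 *: v) => //.
  apply/in_unit_ball.
  by rewrite normrZ gtr0_norm ?invr_gt0// mulVf// gt_eqF.
have [g ->] := linear_canonical fd.1.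
by rewrite linearZ /= normrM gtr0_norm ?invr_gt0// ler_pdivrMl// mulr1.
Qed.

Lemma dual_pair_dual (R : realType) (X Y : normedModType R)
  (f : X -> R^o) (g : Y -> R^o) :
  dual X f -> dual Y g -> dual (X * Y)%type (dual_pair f g).
Proof.
move=> [fl fc] [gl gc]; split=> [a u v|p].
  by rewrite /dual_pair /= fl gl scalerDr addrACA.
apply: cvgD.
  by apply: (@cvg_comp _ _ _ fst f); [exact: cvg_fst | exact: fc].
by apply: (@cvg_comp _ _ _ snd g); [exact: cvg_snd | exact: gc].
Qed.

Lemma dual_comb (R : realType) (V : normedModType R) (a c : R) (f g : V -> R^o) :
  dual V f -> dual V g -> dual V (a *: f + c *: g).
Proof.
move=> [fl fc] [gl gc]; split=> [d u v|p].
  rewrite /= !fctE /= fl gl.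
  by rewrite !scalerDr !scalerA !(mulrC _ d) addrACA.
by apply: cvgD; apply: cvgZl_tmp; [exact: fc | exact: gc].
Qed.

Lemma closure_le (R : realType) (V : normedModType R) (f : V -> R^o) (D : set V)
  (r : R) :
  dual V f -> (forall v, D v -> f v <= r) -> forall v, closure D v -> f v <= r.
Proof.
move=> [_ fc] fr v.
suff /closure_id : closed [set v | f v <= r].
  by move=> ce /(closure_subset (B := [set v | f v <= r]) fr); rewrite -ce.
apply: (@closed_comp _ _ f [set x | x <= r]); last exact: closed_le.
by move=> ? _; exact: fc.
Qed.

Lemma closure_add_ball (R : realType) (V : normedModType R) (f : V -> R^o)
  (C : set V) (r : R) : 0 <= r ->
  dual_unit_ball V f -> (forall v, C v -> f v <= 0) ->
  forall v, closure (set_add C (set_scale r (unit_ball V))) v -> f v <= r.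
Proof.
move=> r0 /dual_unit_ballP[fd fn] fC.
apply: closure_le => // _ [c Cc [u /(scale_unit_ball _ r0) ur <-]].
have [g fg] := linear_canonical fd.1; move: fn fC; rewrite fg => fn fC.
rewrite linearD -[leRHS]add0r lerD ?fC//.
exact: le_trans (ler_norm _) (le_trans (fn u) ur).
Qed.

(** A point outside the closure of [C + B] is at distance more than 1 from [C]. The
    distance to [C] is sublinear, so some linear functional below it attains it
    at [x]; being below the distance means norm at most 1 and sign at most 0 on [C].
    The cone [H] of the proof imposes these conditions on a functional below
    the norm. *)
Lemma separate_cone_ball (R : realType) (V : normedModType R) (C : set V)
  (x : V) :
  convex_cone C -> ~ closure (set_add C (unit_ball V)) x ->
  exists2 f, dual_unit_ball V f & (forall v, C v -> f v <= 0) /\ 1 < f x.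
Proof.
move=> [C0 CD CZ] xC.
have [d d0 hd] : exists2 d : R, 0 < d & forall c, C c -> 1 + d <= `|x - c|.
  apply: contra_notP xC => nd B /nbhs_ballP[e /= e0 eB].
  have [c [Cc xc]] : exists c, C c /\ `|x - c| < 1 + e / 2.
    apply: contra_notP nd => nc; exists (e / 2) => [|c Cc]; first lra.
    by rewrite leNgt; apply/negP => xc; apply: nc; exists c.
  have e1 : 0 < 1 + e / 2 by lra.
  (* Shrinking [x - c] by the factor [1 + e / 2] brings it into the unit ball and
     moves it by at most [e / 2]. *)
  exists (c + (1 + e / 2)^-1 *: (x - c)); split.
    exists c => //; exists ((1 + e / 2)^-1 *: (x - c)) => //; apply/in_unit_ball.
    by rewrite normrZ gtr0_norm ?invr_gt0// ler_pdivrMl// mulr1 ltW.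
  apply: eB; rewrite -ball_normE /ball_ /= opprD addrA.
  rewrite -[X in `|X - _|]scale1r -scalerBl normrZ.
  have -> : 1 - (1 + e / 2)^-1 = (e / 2) / (1 + e / 2) by field; lra.
  rewrite gtr0_norm; last by rewrite divr_gt0//; lra.
  rewrite mulrAC ltr_pdivrMr// mulrC (mulrC e).
  have := normr_ge0 (x - c); move: (`|x - c|) xc => t; nra.
pose H : set (V * R^o)%type :=
  [set w | exists s c, [/\ 0 <= s, C c & w = (s *: x - c, s * (1 + d))]].
have [||f fl [fle fge]] := @sandwich R V (fun v => `|v|) H (sublinear_norm V).
- split.
  + by exists 0, 0; rewrite scale0r mul0r subr0; split.
  + move=> _ _ [s [c [s0 Cc ->]]] [t [c' [t0 Cc' ->]]].
    exists (s + t), (c + c'); split; [exact: addr_ge0|exact: CD|].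
    by rewrite scalerDl mulrDl opprD addrACA.
  + move=> a _ a0 [s [c [s0 Cc ->]]]; exists (a * s), (a *: c).
    split; [exact: (mulr_ge0 (ltW a0) s0)|exact: CZ|].
    by rewrite -scalerA -mulrA -scalerBr.
- move=> _ [s [c [s0 Cc ->]]] /=; move: s0; rewrite le_eqVlt.
  move=> /predU1P[<-|s0]; first by rewrite mul0r.
  have /hd : C (s^-1 *: c) by apply: CZ; rewrite ?invr_gt0.
  rewrite -(ler_pM2l s0) -{2}(gtr0_norm s0) -normrZ scalerBr scalerA.
  by rewrite divff ?gt_eqF// scale1r.
have [fd fn] : dual V f /\ (forall v, `|f v| <= 1 * `|v|).
  by apply: dual_le_norm => // v; rewrite mul1r.
exists f; first by apply/dual_unit_ballP; split=> // v; have := fn v; rewrite mul1r.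
split=> [c Cc|].
  have /fge /= : H (- c, 0) by exists 0, c; rewrite scale0r mul0r sub0r.
  by have [g ->] := linear_canonical fl; rewrite linearN oppr_ge0.
have /fge /= : H (x, 1 + d) by exists 1, 0; rewrite scale1r mul1r subr0.
by apply: lt_le_trans; rewrite ltrDl.
Qed.

(** * Tangent and normal cones *)

(** Convexity is where the moving base points in the definition matter: a sequence
    realizing [u] moves the base points [a_n] to [a_n + t_n u_n], which still tend to
    [a], and [v] may then be realized from there. *)
Lemma clarke_tangent_cone (R : realType) (V : normedModType R) (C : set V)
  (a : V) : convex_cone (clarke_tangent C a).
Proof.
split.
- move=> a_ t_ Ca _ _ _; exists (fun=> 0); first exact: cvg_cst.
  by move=> n; rewrite scaler0 addr0.
- move=> u v Hu Hv a_ t_ Ca aa t0 tt.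
  have [u_ uu Cu] := Hu _ _ Ca aa t0 tt.
  have [|v_ vv Cv] := Hv _ _ Cu _ t0 tt.
    rewrite -[a]addr0 -(scale0r u); apply: cvgD => //; exact: cvgZ.
  exists (fun n => u_ n + v_ n); first exact: cvgD.
  by move=> n; rewrite scalerDr addrA.
- move=> r v r0 Hv a_ t_ Ca aa t0 tt.
  have [||v_ vv Cv] := Hv a_ (fun n => t_ n * r) Ca aa.
  + by move=> n; rewrite mulr_gt0.
  + by rewrite -(mul0r r); apply: cvgMr_tmp.
  exists (fun n => r *: v_ n); first exact: cvgZl_tmp.
  by move=> n; rewrite scalerA.
Qed.

Lemma clarke_tangent_swap (R : realType) (U V : normedModType R)
  (C : set (U * V)%type) (a : U) (b : V) (u : U) (v : V) :
  clarke_tangent C (a, b) (u, v) ->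
  clarke_tangent ([set p | C (p.2, p.1)] : set (V * U)%type) (b, a) (v, u).
Proof.
move=> H p_ t_ Cp pp t0 tt.
have [|w_ ww Cw] := H (fun n => ((p_ n).2, (p_ n).1)) t_ Cp _ t0 tt.
  apply: cvg_pair.
    by apply: cvg_comp pp _; exact: cvg_snd.
  by apply: cvg_comp pp _; exact: cvg_fst.
exists (fun n => ((w_ n).2, (w_ n).1)); last exact: Cw.
apply: cvg_pair.
  by apply: cvg_comp ww _; exact: cvg_snd.
by apply: cvg_comp ww _; exact: cvg_fst.
Qed.

(** Scaling passes to the hull since the preimage of a convex set by a homothety is
    convex; a sum is twice a midpoint. *)
Lemma convex_hull_cone (R : realType) (V : lmodType R) (C : set V) :
  C 0 -> (forall a v, 0 < a -> C v -> C (a *: v)) -> convex_cone (convex_hull C).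
Proof.
move=> C0 CZ.
have hZ a v : 0 < a -> convex_hull C v -> convex_hull C (a *: v).
  move=> a0 Cv D [Dconv CD].
  suff : [set w | D (a *: w)] v by [].
  apply: Cv; split=> [x y l|w Cw]; last by apply: CD; exact: CZ.
  rewrite !inE /= => xD yD.
  have -> : a *: (conv l x y : V) =
      conv l (a *: x : convex_lmodType V) (a *: y : convex_lmodType V).
    by rewrite /conv /= scalerDr !scalerA !(mulrC a).
  by rewrite -inE; apply: Dconv; rewrite inE.
split=> //.
  by move=> D [_]; apply.
move=> u v Cu Cv.
have -> : u + v = 2 *: (2^-1 *: u + 2^-1 *: v).
  by rewrite -scalerDr scalerA divff ?pnatr_eq0// scale1r.
apply: hZ => // D [Dconv CD].
have h0 : (0 : R) <= 2^-1 by lra.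
have h1 : (2^-1 : R) <= 1 by lra.
pose l : {i01 R} := Itv01 h0 h1.
have := Dconv u v l; rewrite !inE => /(_ (Cu _ (conj Dconv CD)) (Cv _ (conj Dconv CD))).
have -> : conv l (u : convex_lmodType V) (v : convex_lmodType V) =
    2^-1 *: u + (1 - 2^-1) *: v by [].
by have -> : 1 - 2^-1 = 2^-1 :> R by field.
Qed.

Lemma contingent_cone0 (R : realType) (V : normedModType R) (C : set V) (a : V) :
  C a -> contingent_cone C a 0.
Proof.
move=> Ca; exists (fun=> 0), (fun n => n.+1%:R^-1); split.
- exact: cvg_cst.
- by move=> n; rewrite invr_gt0.
- exact: cvg_harmonic.
- by move=> n; rewrite scaler0 addr0.
Qed.

Lemma contingent_coneZ (R : realType) (V : normedModType R) (C : set V) (a : V)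
  (r : R) (v : V) : 0 < r -> contingent_cone C a v -> contingent_cone C a (r *: v).
Proof.
move=> r0 [v_ [t_ [vv t0 tt Ct]]].
exists (fun n => r *: v_ n), (fun n => t_ n / r); split.
- exact: cvgZl_tmp.
- by move=> n; rewrite divr_gt0.
- by rewrite -(mul0r r^-1); exact: cvgMr_tmp.
- by move=> n; rewrite scalerA divfK ?gt_eqF.
Qed.

(** Along points [a + t_n v_n] realizing a contingent vector [v <> 0], the difference
    quotients of [f] tend to [f v / |v|], which is therefore at most their limsup. *)
Lemma frechet_normal_contingent (R : realType) (V : normedModType R)
  (C : set V) (a : V) (f : V -> R^o) (v : V) :
  frechet_normal C a f -> contingent_cone C a v -> f v <= 0.
Proof.
move=> [[fl fc] fN] [v_ [t_ [vv t0 tt Ct]]].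
have [f0 fD fZ] := linear_real fl.
rewrite leNgt; apply/negP => fv.
have v0 : 0 < `|v|.
  by rewrite normr_gt0; apply/eqP => v0; move: fv; rewrite v0 f0 ltxx.
(* Half of the limit [f v / |v|] of the quotients. *)
pose e := f v / (2 * `|v|).
have e0 : 0 < e by rewrite divr_gt0// mulr_gt0.
have /ereal_inf_lt[_ [U aU <-] Ue] : (limf_esup
    (fun y : V => (f (y - a) / `|y - a|)%:E) (within C a^') < e%:E)%E.
  by apply: le_lt_trans fN _; rewrite lte_fin.
have fe : \forall n \near \oo, 0 < f (v_ n) - e * `|v_ n|.
  apply: (@cvgr_gt _ _ _ _ _ (f v - e * `|v|)); last first.
    have -> : e * `|v| = f v / 2 by rewrite /e; field; rewrite gt_eqF.
    by move: (f v) fv => c; lra.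
  apply: cvgB; first exact: (cvg_comp _ _ vv (fc v)).
  apply: cvgMl_tmp; exact: cvg_norm.
have an : a + t_ n *: v_ n @[n --> \oo] --> a.
  by rewrite -[X in _ --> X]addr0 -(scale0r v); apply: cvgD;
    [exact: cvg_cst | exact: cvgZ].
have nU := an _ aU.
near \oo => n.
have fen : 0 < f (v_ n) - e * `|v_ n| by near: n.
have vn0 : 0 < `|v_ n|.
  rewrite normr_gt0; apply/eqP => vn0; move: fen.
  by rewrite vn0 f0 normr0 mulr0 subr0 ltxx.
have /(_ _ (Ct n)) Un : a + t_ n *: v_ n != a -> C (a + t_ n *: v_ n) ->
    U (a + t_ n *: v_ n).
  by near: n.
have /Un Un' : a + t_ n *: v_ n != a.
  rewrite -subr_eq0 addrC addKr scaler_eq0 negb_or gt_eqF//=.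
  by rewrite -normr_gt0.
have := le_lt_trans (ereal_sup_ubound _) Ue.
move=> /(_ (f (v_ n) / `|v_ n|)%:E); rewrite lte_fin.
have h : ([set (f (y - a) / `|y - a|)%:E | y in U]) (f (v_ n) / `|v_ n|)%:E.
  exists (a + t_ n *: v_ n); first exact: Un'.
  rewrite addrC addKr fZ normrZ gtr0_norm//; congr (_%:E).
  by rewrite invfM mulrACA divff ?mul1r// gt_eqF.
by move=> /(_ h); rewrite ltr_pdivrMr// => hh; move: fen; rewrite subr_gt0 ltNge ltW.
Unshelve. all: by end_near. Qed.

(** If the limsup exceeded some [e > 0], points [y_n] of [C] tending to [a] would have
    normalized directions [u_n] with [f (u_n) > e]. By compactness of the ball the
    directions cluster at a contingent vector, where [f] is at least [e]. *)
Lemma contingent_frechet_normal (R : realType) (V : normedModType R)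
  (C : set V) (a : V) (f : V -> R^o) :
  compact (unit_ball V) -> dual V f ->
  (forall v, contingent_cone C a v -> f v <= 0) -> frechet_normal C a f.
Proof.
move=> Bco fd fT; split=> //; have [fl fc] := fd.
have [f0 fD fZ] := linear_real fl.
apply/lee_addgt0Pr => e e0; rewrite add0e.
pose U := [set y : V | f (y - a) / `|y - a| <= e].
suff aU : within C a^' U.
  apply: le_trans (ereal_inf_lbound _) _; first by exists U.
  by apply: ge_ereal_sup => _ [y Uy <-]; rewrite lee_fin.
apply: contrapT => naU.
have /choice[y_ Hy] : forall n : nat, exists y,
    [/\ C y, y != a, `|y - a| < n.+1%:R^-1 & e < f (y - a) / `|y - a|].
  move=> n; apply: contra_notP naU => ny.
  apply/nbhs_ballP; exists n.+1%:R^-1; first by rewrite /= invr_gt0.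
  move=> y; rewrite -ball_normE /ball_ /= distrC => ay ya Cy.
  by rewrite /U /= leNgt; apply/negP => fy; apply: ny; exists y.
pose t n := `|y_ n - a|.
have t0 n : 0 < t n by have [_ ya _ _] := Hy n; rewrite /t normr_gt0 subr_eq0.
pose u n := (t n)^-1 *: (y_ n - a).
have fu n : e < f (u n) by have [_ _ _] := Hy n; rewrite fZ mulrC.
have uB n : unit_ball V (u n).
  by apply/in_unit_ball; rewrite normrZ gtr0_norm ?invr_gt0// mulVf// gt_eqF.
have [|w [_ wu]] := Bco (u @ \oo) _.
  by exists 0%N => // n _; exact: uB.
have /choice[k_ Hk] : forall k : nat, exists n, (k <= n)%N /\ `|w - u n| < k.+1%:R^-1.
  move=> k.
  have [||_ [[n kn <-] wn]] :=
    wu (u @` [set n | (k <= n)%N]) (ball w k.+1%:R^-1).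
  - by exists k => // n kn; exists n.
  - by apply: nbhsx_ballx; rewrite invr_gt0.
  - by exists n; split=> //; move: wn; rewrite -ball_normE.
have harm : (fun n => n.+1%:R^-1 : R) @ \oo --> (0 : R) by exact: cvg_harmonic.
have uw : (fun k => u (k_ k)) @ \oo --> w.
  apply/cvgrPdist_lt => d d0; near=> n.
  apply: lt_trans (Hk n).2 _; near: n.
  exact: (cvgr_lt _ harm).
have : contingent_cone C a w.
  exists (fun k => u (k_ k)), (fun k => t (k_ k)); split => //.
  - apply: (squeeze_cvgr _ (cvg_cst 0) harm); near=> k.
    rewrite normr_ge0 /=; have [_ _ /ltW h _] := Hy (k_ k).
    apply: le_trans h _; rewrite lef_pV2 ?posrE// ler_nat ltnS.
    exact: (Hk k).1.
  - move=> k; rewrite scalerA divff ?gt_eqF// scale1r addrC subrK.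
    by have [] := Hy (k_ k).
move=> /fT fw.
have : e <= f w.
  apply: (closed_cvg (fun r : R => e <= r) _ _ _ (cvg_comp _ _ uw (fc w))).
    exact: closed_ge.
  by near=> k => /=; exact/ltW.
by move=> /(lt_le_trans e0); rewrite ltNge fw.
Unshelve. all: by end_near. Qed.

(** * Compactness of balls in finite dimension *)

Lemma combination_continuous (R : realType) (V : normedModType R) (n : nat)
  (e : 'I_n -> V) : continuous (fun c : 'rV[R]_n => \sum_i c 0 i *: e i).
Proof.
apply: continuous_big => [|i _ c]; first exact: add_continuous.
exact: (cvgZr_tmp (F := nbhs c) (coord_continuous (x := c))).
Qed.

Lemma rV_norm_le (R : realType) (n : nat) (c : 'rV[R]_n) (r : R) : 0 <= r ->
  `|c| <= r <-> (forall i, `|c 0 i| <= r).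
Proof.
move=> r0; rewrite [`|c|]/Num.norm /= mx_normrE; split=> [/bigmax_leP[_ h] i|h].
  exact: (h (0, i)).
by apply/bigmax_leP; split=> // -[i j] _ /=; rewrite (ord1 i).
Qed.

(** Every combination of [e] has coordinates controlled by its norm, even when [e] is
    linearly dependent: a nontrivial relation removes one vector and the induction
    applies, and for independent [e] the image of the unit sphere of coordinates is
    compact and avoids 0, hence stays away from it. *)
Lemma coordinates_bounded (R : realType) (V : normedModType R) (n : nat)
  (e : 'I_n -> V) :
  exists2 M : R, 0 <= M & forall c : 'rV[R]_n, exists2 d : 'rV[R]_n,
    \sum_i d 0 i *: e i = \sum_i c 0 i *: e i &
    `|d| <= M * `|\sum_i c 0 i *: e i|.
Proof.
elim: n e => [|n IH] e.
  by exists 0 => // c; exists 0; rewrite ?big_ord0 ?normr0 ?mulr0.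
pose phi (c : 'rV[R]_n.+1) : V := \sum_i c 0 i *: e i.
have phiZ a c : phi (a *: c) = a *: phi c.
  by rewrite /phi scaler_sumr; apply: eq_bigr => i _; rewrite mxE scalerA.
have [[c0 [c0n0 c0ker]]|inj] := pselect (exists c, c != 0 /\ phi c = 0).
- have [k ck] : exists k, c0 0 k != 0.
    by move/rV0Pn : c0n0.
  have [M M0 HM] := IH (e \o lift k).
  exists M => // c.
  pose c' := c - (c 0 k / c0 0 k) *: c0.
  have c'k : c' 0 k = 0 by rewrite /c' !mxE divfK// subrr.
  have phic' : phi c' = phi c.
    have -> : phi c' = phi c - phi ((c 0 k / c0 0 k) *: c0).
      rewrite /phi -sumrB; apply: eq_bigr => i _.
      by rewrite -scalerBl /c' !mxE.
    by rewrite phiZ c0ker scaler0 subr0.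
  have [d dE dM] := HM (\row_i c' 0 (lift k i)).
  pose d' : 'rV[R]_n.+1 := \row_i oapp (d 0) 0 (unlift k i).
  have sumc' : \sum_i (\row_i c' 0 (lift k i)) 0 i *: (e \o lift k) i = phi c.
    rewrite -phic' /phi (bigD1_ord k)//= c'k scale0r add0r.
    by apply: eq_bigr => i _; rewrite mxE.
  rewrite -/(phi c); exists d'.
    rewrite (bigD1_ord k)//= mxE unlift_none /= scale0r add0r -sumc' -dE.
    by apply: eq_bigr => i _; rewrite mxE liftK.
  rewrite sumc' in dM; apply: le_trans dM.
  apply/rV_norm_le => // i; rewrite mxE; case: unliftP => [j _|_] /=.
    by move: j; exact/rV_norm_le.
  by rewrite normr0.
- pose S := [set c : 'rV[R]_n.+1 | `|c| = 1].
  have phic : continuous phi.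
    exact: combination_continuous.
  have Sco : compact S.
    apply: bounded_closed_compact.
      exists 1; split; first exact: num_real.
      by move=> x x1 c /= ->; exact: ltW.
    apply: (@closed_comp _ _ (fun c : 'rV[R]_n.+1 => `|c|) [set x | x = 1]).
      by move=> c _; exact: norm_continuous.
    exact: closed_eq.
  have phiS : closed (phi @` S).
    apply: compact_closed; first exact: norm_hausdorff.
    apply: continuous_compact => //; exact: continuous_subspaceT.
  have : nbhs 0 (~` (phi @` S)).
    apply: open_nbhs_nbhs; split; first exact: closed_openC.
    move=> [c c1 c0]; apply: inj; exists c; split=> //.
    by rewrite -normr_eq0 c1 oner_eq0.
  move=> /nbhs_ballP[r /= r0 rS].
  exists r^-1; first by rewrite invr_ge0 ltW.
  move=> c; exists c => //; rewrite -/(phi c) ler_pdivlMl//.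
  have [->|cn0] := eqVneq c 0; first by rewrite normr0 mulr0.
  have cn : 0 < `|c| by rewrite normr_gt0.
  rewrite leNgt; apply/negP => rc.
  have := rS (phi (`|c|^-1 *: c)); apply.
    rewrite -ball_normE /ball_ /= sub0r normrN phiZ normrZ gtr0_norm ?invr_gt0//.
    by rewrite ltr_pdivrMl// mulrC.
  have c1 : `|(`|c|^-1 *: c)| = 1.
    by rewrite normrZ gtr0_norm ?invr_gt0// mulVf ?gt_eqF.
  by exists (`|c|^-1 *: c).
Qed.

Lemma finite_dimensional_compact_ball (R : realType) (V : normedModType R) :
  finite_dimensional V -> compact (unit_ball V).
Proof.
move=> [n [e span]]; have [M M0 HM] := coordinates_bounded e.
pose phi (c : 'rV[R]_n) : V := \sum_i c 0 i *: e i.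
pose B := [set c : 'rV[R]_n | `|c| <= M].
have Bco : compact B.
  apply: bounded_closed_compact.
    exists M; split; first exact: num_real.
    by move=> x x1 c /= cM; apply: le_trans cM (ltW x1).
  apply: (@closed_comp _ _ (fun c : 'rV[R]_n => `|c|) [set x | x <= M]).
    by move=> c _; exact: norm_continuous.
  exact: closed_le.
have phiB : compact (phi @` B).
  apply: continuous_compact => //; apply: continuous_subspaceT.
  exact: combination_continuous.
apply: subclosed_compact phiB _; first exact: closed_ball_closed.
move=> x /in_unit_ball x1; have [c xc] := span x.
have xE : \sum_i (\row_j c j) 0 i *: e i = x.
  by rewrite xc; apply: eq_bigr => i _; rewrite mxE.
have [d dE dM] := HM (\row_j c j).
exists d; last by rewrite /phi dE.
by move: dM; rewrite xE => /le_trans; apply; rewrite ler_piMr.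
Qed.

(** * Duality between the inclusions and the qualification conditions *)

(** From the primal side to multipliers. Homogeneity turns the hypothesis into
    [f x / tau <= |y| + |x - t|] for all [(y, x)] in the tangent cone of the graph of
    [F^-1] and all [t] tangent to [A]. The sandwich theorem on [Y * X] then produces a
    functional [(y, x) |-> ys y + v x] below [|y| + |x|] and above [f x / tau] at
    [(y, x - t)]. The first bound makes [ys] and [v] of norm at most 1; the second,
    with [x = y = 0], says that [v] is normal to [A] and, with [t = 0], that
    [f / tau - v] belongs to the coderivative at [ys]. *)
Lemma BCQ_bound_of_le1 (R : realType) (X Y : normedModType R)
  (F : multifunction X Y) (A : set X) (b : Y) (z : X) (tau : R) (f : X -> R^o) :
  0 < tau -> dual X f ->
  (forall x,
    multi_image (clarke_derivative (multi_inv F) b z)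
                (set_scale tau^-1 (unit_ball Y)) x ->
    set_add (clarke_tangent A z) (set_scale tau^-1 (unit_ball X)) x ->
    f x <= 1) ->
  BCQ_bound F A b z tau f.
Proof.
move=> tau0 fd f1; have [f0 fD fZ] := linear_real fd.1.
pose K : set (Y * X)%type :=
  clarke_tangent (graph (multi_inv F) : set (Y * X)%type) (b, z).
have [K0 KD KZ] : convex_cone K by exact: clarke_tangent_cone.
have [T0 TD TZ] := clarke_tangent_cone A z.
pose p (w : (Y * X)%type) : R := `|w.1| + `|w.2|.
have ps : sublinear p.
  split=> [u v|a v a0]; rewrite /p /=.
    by have := ler_normD u.1 v.1; have := ler_normD u.2 v.2; lra.
  by rewrite !normrZ ger0_norm// mulrDr.
have bound y x t : K (y, x) -> clarke_tangent A z t ->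
    tau^-1 * f x <= `|y| + `|x - t|.
  (* The extra [e] keeps the scaling factor finite when [y = 0] and [x = t]. *)
  move=> Kyx Tt; apply/ler_addgt0Pr => e e0.
  set r := _ + _ + e.
  have r0 : 0 < r by rewrite /r; have := normr_ge0 y; have := normr_ge0 (x - t); lra.
  have tr0 : 0 < (tau * r)^-1 by rewrite invr_gt0 mulr_gt0.
  have taui0 : 0 <= tau^-1 by rewrite invr_ge0 ltW.
  have small (V : normedModType R) (v : V) : `|v| <= r ->
      set_scale tau^-1 (unit_ball V) ((tau * r)^-1 *: v).
    move=> vr; apply/scale_unit_ball => //.
    rewrite normrZ gtr0_norm// invfM -mulrA ler_piMr//.
    by rewrite mulrC ler_pdivrMr// mul1r.
  have := f1 ((tau * r)^-1 *: x); rewrite fZ.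
  have -> : (tau * r)^-1 * f x = tau^-1 * f x / r :> R.
    by rewrite invfM mulrAC.
  rewrite ler_pdivrMr// mul1r; apply.
    exists ((tau * r)^-1 *: y).
      by apply: small; rewrite /r; have := normr_ge0 (x - t); lra.
    exact: (KZ _ _ tr0 Kyx).
  exists ((tau * r)^-1 *: t); first exact: TZ.
  exists ((tau * r)^-1 *: (x - t)); last by rewrite -scalerDr addrC subrK.
  by apply: small; rewrite /r; have := normr_ge0 y; lra.
pose H : set ((Y * X) * R^o)%type := [set w | exists y x t,
  [/\ K (y, x), clarke_tangent A z t & w = ((y, x - t), tau^-1 * f x)]].
have [||h hl [hle hge]] := @sandwich R _ p H ps.
- split.
  + by exists 0, 0, 0; rewrite f0 mulr0 subr0; split.
  + move=> _ _ [y [x [t [Kyx Tt ->]]]] [y' [x' [t' [Kyx' Tt' ->]]]].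
    exists (y + y'), (x + x'), (t + t'); split; [exact: (KD _ _ Kyx Kyx')|exact: TD|].
    by rewrite fD mulrDr opprD addrACA.
  + move=> a _ a0 [y [x [t [Kyx Tt ->]]]]; exists (a *: y), (a *: x), (a *: t).
    split; [exact: (KZ _ _ a0 Kyx)|exact: TZ|].
    by rewrite fZ -scalerBr mulrCA.
- by move=> _ [y [x [t [Kyx Tt ->]]]]; exact: bound.
have [k hk] := linear_canonical hl.
pose ys : Y -> R^o := fun y => h (y, 0).
pose v : X -> R^o := fun x => h (0, x).
have ysl : linear ys.
  by move=> a u w; rewrite /ys -hl /=; congr h; congr pair; rewrite /= scaler0 addr0.
have vl : linear v.
  by move=> a u w; rewrite /v -hl /=; congr h; congr pair; rewrite /= scaler0 addr0.
have hE y x : h (y, x) = ys y + v x.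
  rewrite /ys /v hk -linearD; congr (k _).
  by congr pair; rewrite /= ?addr0 ?add0r.
have ysB : dual_unit_ball Y ys.
  have [|ysd ysn] := @dual_le_norm R Y ys 1 ysl.
    by move=> y; have := hle (y, 0); rewrite /p /= normr0 addr0 mul1r.
  by apply/dual_unit_ballP; split=> // y; rewrite -[leRHS]mul1r.
have vB : dual_unit_ball X v.
  have [|vd vn] := @dual_le_norm R X v 1 vl.
    by move=> x; have := hle (0, x); rewrite /p /= normr0 add0r mul1r.
  by apply/dual_unit_ballP; split=> // x; rewrite -[leRHS]mul1r.
have [/dual_unit_ballP[ysd _] /dual_unit_ballP[vd _]] := (ysB, vB).
have [g' vg'] := linear_canonical vl.
pose u := tau^-1 *: f + (-1) *: v.
have ud : dual X u by exact: dual_comb.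
exists (u + v); last first.
  rewrite /u scaleN1r subrK scalerA divff ?gt_eqF// scale1r//.
exists u; last exists v => //.
  exists ys => //; split => //; split.
    apply: dual_pair_dual => //.
    by have := dual_comb (-1) 0 ysd ysd; rewrite scaleN1r scale0r addr0.
  (* The members of [H] with [t = 0] express that [(u, - ys)] is normal to the graph. *)
  move=> [x y] /clarke_tangent_swap Kyx.
  have /hge /= : H ((y, x), tau^-1 * f x) by exists y, x, 0; rewrite subr0.
  rewrite hE /dual_pair /=.
  have -> : u x = tau^-1 * f x - v x by rewrite /u scaleN1r.
  have -> : (- ys) y = - ys y by [].
  by move: (v x) (ys y) (f x) => c d e; lra.
split=> //; split=> // t Tt.
(* The members of [H] with [x = y = 0] express that [v] is normal to [A]. *)
have /hge /= : H ((0, - t), 0).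
  by exists 0, 0, t; rewrite sub0r f0 mulr0.
by rewrite hE vg' linearN /ys hk linear0 add0r oppr_ge0.
Qed.

(** From multipliers to the primal side: if [f = tau (u + v)], the coderivative gives
    [u x <= ys y <= eta1] on the first set, and [v <= eta2] on the second since [v] is
    nonpositive on the tangent cone and of norm at most 1. *)
Lemma BCQ_bound_le1 (R : realType) (X Y : normedModType R)
  (F : multifunction X Y) (A : set X) (b : Y) (z : X) (tau : R) (f : X -> R^o)
  (eta1 eta2 : R) (x : X) :
  0 < tau -> 0 <= eta1 -> 0 <= eta2 -> eta1 + eta2 <= tau^-1 ->
  BCQ_bound F A b z tau f ->
  closure (multi_image (clarke_derivative (multi_inv F) b z)
                       (set_scale eta1 (unit_ball Y))) x ->
  closure (set_add (clarke_tangent A z) (set_scale eta2 (unit_ball X))) x ->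
  f x <= 1.
Proof.
move=> tau0 e10 e20 e12 [_ [u [ys ysB [ud [_ uN]]] [v [[_ vN] vB] <-]] <-].
move=> xD xT.
have ux : u x <= eta1.
  apply: (closure_le ud _ xD) => w [y /(scale_unit_ball _ e10) ye].
  move=> /clarke_tangent_swap/uN /=; rewrite /dual_pair /= fctE => h.
  have /dual_unit_ballP[_ /(_ y) yn] := ysB.
  have := le_trans (ler_norm _) (le_trans yn ye).
  have /le_trans : u w <= ys y by rewrite -subr_le0.
  exact.
have vx : v x <= eta2 by exact: (closure_add_ball e20 vB vN xT).
rewrite fctE /= fctE.
have -> : tau *: (u x + v x) = tau * (u x + v x) by [].
by rewrite -ler_pdivlMl// mulr1 (le_trans _ e12)// lerD.
Qed.

Theorem theorem3p2 (R : realType) (X Y : completeNormedModType R)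
  (F : multifunction X Y) (A : set X) (b : Y) (z : X) (tau : R)
  (Fclosed : closed (graph F : set (X * Y)%type)) (Aclosed : closed A)
  (zS : solution_set F A b z) (tau_gt0 : 0 < tau) :
  let S := solution_set F A b in
  let DFinv := clarke_derivative (multi_inv F) b z in
  [/\ (closure (multi_image DFinv (set_scale tau^-1 (unit_ball Y))) `&`
       closure (set_add (clarke_tangent A z) (set_scale tau^-1 (unit_ball X)))
         `<=` closure (set_add (clarke_tangent S z) (unit_ball X)) ->
       strong_BCQ_clarke F A b z tau),
      (closure (multi_image DFinv (set_scale tau^-1 (unit_ball Y))) `&`
       closure (set_add (clarke_tangent A z) (set_scale tau^-1 (unit_ball X)))
         `<=` closure (set_add (contingent_cone S z) (unit_ball X)) ->
       strong_BCQ_frechet F A b z tau),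
      (strong_BCQ_clarke F A b z tau ->
       forall eta1 eta2 : R, 0 <= eta1 -> 0 <= eta2 ->
         eta1 + eta2 <= tau^-1 ->
         closure (multi_image DFinv (set_scale eta1 (unit_ball Y))) `&`
         closure (set_add (clarke_tangent A z) (set_scale eta2 (unit_ball X)))
           `<=` closure (set_add (clarke_tangent S z) (unit_ball X))) &
      (finite_dimensional X -> strong_BCQ_frechet F A b z tau ->
       forall eta1 eta2 : R, 0 <= eta1 -> 0 <= eta2 ->
         eta1 + eta2 <= tau^-1 ->
         closure (multi_image DFinv (set_scale eta1 (unit_ball Y))) `&`
         closure (set_add (clarke_tangent A z) (set_scale eta2 (unit_ball X)))
           `<=` closure (set_add (convex_hull (contingent_cone S z))
                                 (unit_ball X)))].
Proof.
move=> S DFinv.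
have primal_dual (C : set X) (f : X -> R^o) :
    closure (multi_image DFinv (set_scale tau^-1 (unit_ball Y))) `&`
    closure (set_add (clarke_tangent A z) (set_scale tau^-1 (unit_ball X)))
      `<=` closure (set_add C (unit_ball X)) ->
    dual_unit_ball X f -> (forall v, C v -> f v <= 0) ->
    BCQ_bound F A b z tau f.
  move=> incl fB fC; apply: BCQ_bound_of_le1 => //.
    by have /dual_unit_ballP[] := fB.
  move=> x xD xT; apply: (closure_add_ball ler01 fB fC).
  have -> : set_scale 1 (unit_ball X) = unit_ball X.
    apply/seteqP; split=> [_ [u uB <-]|u uB]; first by rewrite scale1r.
    by exists u; rewrite ?scale1r.
  by apply: incl; split; exact: subset_closure.
have dual_primal (C : set X) (eta1 eta2 : R) :
    convex_cone C ->
    (forall f, dual_unit_ball X f -> (forall v, C v -> f v <= 0) ->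
      BCQ_bound F A b z tau f) ->
    0 <= eta1 -> 0 <= eta2 -> eta1 + eta2 <= tau^-1 ->
    closure (multi_image DFinv (set_scale eta1 (unit_ball Y))) `&`
    closure (set_add (clarke_tangent A z) (set_scale eta2 (unit_ball X)))
      `<=` closure (set_add C (unit_ball X)).
  move=> Cc CB e10 e20 e12 x [xD xT]; apply: contrapT => xC.
  have [f fB [fC]] := separate_cone_ball Cc xC.
  rewrite ltNge => /negP; apply.
  exact: (BCQ_bound_le1 tau_gt0 e10 e20 e12 (CB f fB fC) xD xT).
split.
- by move=> incl f [[_ fN] fB]; exact: (primal_dual _ _ incl fB fN).
- move=> incl f [fN fB]; apply: (primal_dual _ _ incl fB) => v.
  exact: frechet_normal_contingent fN.
- move=> BCQ eta1 eta2; apply: dual_primal; first exact: clarke_tangent_cone.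
  by move=> f fB fC; apply: BCQ; split=> //; split=> //; have /dual_unit_ballP[] := fB.
- move=> fd BCQ eta1 eta2; apply: dual_primal.
    apply: convex_hull_cone; first exact: contingent_cone0.
    by move=> a v a0; exact: contingent_coneZ.
  move=> f fB fC; apply: BCQ; split=> //.
  apply: contingent_frechet_normal.
  + exact: finite_dimensional_compact_ball.
  + by have /dual_unit_ballP[] := fB.
  + by move=> v vT; apply: fC => D [_]; exact.
Qed.
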